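(* Let $W=(W,S)$ be a Coxeter group. (a) Let $\delta:G\to W$ be a $W$-groupoid with one chamber, where $G$ is the group of edges, and let $B=\{g\in G:\delta(g)=1\}$. Then $\delta$ factors through the projection $G\to B\backslash G/B$, $g\mapsto BgB$, to give a function $\delta_B:B\backslash G/B\to W$. If $\delta_B$ is injective, then $\delta_B$ is a bijection and $\mathcal{C}:=\delta_B^{-1}:W\to B\backslash G/B$ satisfies: (B) for all $w\in W$ and all $s\in S$: (i) if $ws<w$, then $\mathcal{C}(ws)\subseteq\mathcal{C}(w)\mathcal{C}(s)\subseteq\mathcal{C}(ws)\cup\mathcal{C}(w)$; (ii) if $ws>w$, then $\mathcal{C}(w)\mathcal{C}(s)=\mathcal{C}(ws)$. (b) Conversely, let $G$ be a group with a subgroup $B\leq G$, and let $\delta_B:B\backslash G/B\to W$ be a bijection such that $\mathcal{C}:=\delta_B^{-1}$ satisfies (B). Then the composition $\delta:G\to B\backslash G/B\to W$ of the projection with $\delta_B$ is a $W$-groupoid with one chamber.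
   Context: $W=(W,S)$ is a Coxeter group with generating set $S$, and $\leq$ is the Bruhat order on $W$ (so for $s\in S$, $ws<w$ iff the word length of $ws$ is less than that of $w$). $\mathcal{G}=(\mathcal{G}_0,\mathcal{G}_1)$ denotes a small groupoid with objects (chambers) $\mathcal{G}_0$ and morphisms (edges) $\mathcal{G}_1$; $\iota(g),\tau(g)$ are the source and target of $g$, and if $\tau(g)=\iota(h)$ then $gh=h\circ g$ is the composite. A function $\delta:\mathcal{G}\to W$ means a function $\mathcal{G}_1\to W$. A $W$-groupoid on $\mathcal{G}$ is a function $\delta:\mathcal{G}\to W$ which is weak (for every chamber $C$ and every $s\in S$ there is an edge $g$ with $\iota(g)=C$ and $\delta(g)=s$) and satisfies: (WG1) $\delta(1)=1$ for every identity edge $1$; (WG2) for all edges $g,h$ such that $gh$ is defined, $\delta(gh)\geq\delta(g)\delta(h)$; (WG3) for every edge $g$ and every $s\in S$ with $\delta(g)s<\delta(g)$, there exists an edge $h$ with $\iota(h)=\iota(g)$, $\delta(h^{-1}g)=s$ and $\delta(h)=\delta(g)s$. If $\mathcal{G}$ has only one chamber, it is identified with the group $G=\mathcal{G}_1$ whose product is $(g,h)\mapsto gh$. For subsets $X,Y\subseteq G$, $XY=\{xy:x\in X,y\in Y\}$; elements of $B\backslash G/B$ are regarded as subsets (double cosets) of $G$. Property (B) is the property that defines a Bruhat decomposition. *)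

(* Defs.v *)
From HB Require Import structures.
From Stdlib Require Import Relation_Operators.
From mathcomp Require Import all_boot all_classical.

Set Implicit Arguments.
Unset Strict Implicit.
Unset Printing Implicit Defensive.

Local Open Scope classical_set_scope.
Local Open Scope group_scope.

(* In this file a set [S : set W] is also used as the type of its elements,
   through the coercion [set_type]; [val s : W] is the underlying element. *)

Section Coxeter.
Variables (W : groupType) (S : set W).

Definition word_prod (r : seq S) : W := \prod_(s <- r) val s.

(* [m s t = 0] encodes an infinite entry; it adds no relation below. *)
Definition coxeter_matrix (m : S -> S -> nat) : Prop :=
  [/\ forall s t, m s t = m t s,
      forall s, m s s = 1%N
    & forall s t, s <> t -> m s t <> 1%N].

(* The congruence on the free monoid on [S] generated by (s t)^(m s t) ~ 1.
   As [m s s = 1] gives s s ~ 1, the quotient monoid is already the group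
   presented by these relations. *)
Inductive coxeter_congr (m : S -> S -> nat) : seq S -> seq S -> Prop :=
| coxeter_rel r1 r2 s t :
    coxeter_congr m (r1 ++ flatten (nseq (m s t) [:: s; t]) ++ r2) (r1 ++ r2)
| coxeter_refl r : coxeter_congr m r r
| coxeter_sym r r' : coxeter_congr m r r' -> coxeter_congr m r' r
| coxeter_trans r r' r'' :
    coxeter_congr m r r' -> coxeter_congr m r' r'' -> coxeter_congr m r r''.

(* [S] generates [W], and W = < S | (s t)^(m s t) = 1 > for a Coxeter
   matrix [m]. *)
Definition coxeter_system : Prop :=
  exists m : S -> S -> nat,
    [/\ coxeter_matrix m,
        forall w : W, exists r : seq S, word_prod r = w
      & forall r r' : seq S, word_prod r = word_prod r' <-> coxeter_congr m r r'].

(* The default value 0 is irrelevant when [S] generates [W] as a monoid. *)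
Definition word_length (w : W) : nat :=
  xget 0%N [set n | (exists2 r : seq S, word_prod r = w & size r = n)
                 /\ (forall r : seq S, word_prod r = w -> (n <= size r)%N)].

Definition reflection (t : W) : Prop := exists (s : S) (w : W), t = val s ^ w.

Definition bruhat_step (u w : W) : Prop :=
  exists2 t, reflection t & w = u * t /\ (word_length u < word_length w)%N.

Definition bruhat_le : W -> W -> Prop := clos_refl_trans W bruhat_step.

Definition bruhat_lt (u w : W) : Prop := bruhat_le u w /\ u <> w.

End Coxeter.

(* Composition is in diagrammatic order: [hcomp g h] is the composite written
   gh in a product, i.e. first [g], then [h]. *)
Record groupoid := Groupoid {
  chamber :> Type;
  hom : chamber -> chamber -> Type;
  hid : forall C, hom C C;
  hcomp : forall C D E, hom C D -> hom D E -> hom C E;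
  hinv : forall C D, hom C D -> hom D C;
  hcompA : forall C D E F (g : hom C D) (h : hom D E) (k : hom E F),
    hcomp g (hcomp h k) = hcomp (hcomp g h) k;
  hcomp1h : forall C D (g : hom C D), hcomp (hid C) g = g;
  hcomph1 : forall C D (g : hom C D), hcomp g (hid D) = g;
  hcompVh : forall C D (g : hom C D), hcomp (hinv g) g = hid D;
  hcomphV : forall C D (g : hom C D), hcomp g (hinv g) = hid C }.

Arguments hom {_} C D.
Arguments hid {_} C.
Arguments hcomp {_ C D E} g h.
Arguments hinv {_ C D} g.

(* The group of loops at [C]; it consists of all the edges when [C] is the only
   chamber. *)
Definition edge_group (GG : groupoid) (C : GG) : Type := hom C C.

Section EdgeGroup.
Variables (GG : groupoid) (C : GG).
HB.instance Definition _ := gen_eqMixin (edge_group C).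
HB.instance Definition _ := gen_choiceMixin (edge_group C).
HB.instance Definition _ := isGroup.Build (edge_group C)
  (@hcompA GG C C C C) (@hcomp1h GG C C) (@hcomph1 GG C C)
  (@hcompVh GG C C) (@hcomphV GG C C).
End EdgeGroup.

Definition one_chamber_groupoid (G : groupType) : groupoid :=
  @Groupoid unit (fun _ _ => G) (fun _ => 1)
    (fun _ _ _ g h => g * h) (fun _ _ g => g^-1)
    (fun _ _ _ _ => @mulgA G) (fun _ _ => @mul1g G) (fun _ _ => @mulg1 G)
    (fun _ _ => @mulVg G) (fun _ _ => @mulgV G).

Definition W_groupoid (W : groupType) (S : set W) (GG : groupoid)
    (delta : forall C D : GG, hom C D -> W) : Prop :=
  [/\ forall (C : GG) (s : S), exists (D : GG) (g : hom C D),
        delta C D g = val s,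
      forall C : GG, delta C C (hid C) = 1,
      forall (C D E : GG) (g : hom C D) (h : hom D E),
        bruhat_le S (delta C D g * delta D E h) (delta C E (hcomp g h))
    & forall (C D : GG) (g : hom C D) (s : S),
        bruhat_lt S (delta C D g * val s) (delta C D g) ->
        exists (E : GG) (h : hom C E),
          delta E D (hcomp (hinv h) g) = val s
          /\ delta C E h = delta C D g * val s].

Section DoubleCosets.
Variable G : groupType.

Definition set_mulg (X Y : set G) : set G := [set x * y | x in X & y in Y].

Definition is_subgroup (B : set G) : Prop := group_closed [in B].

Definition double_coset (B : set G) (g : G) : set G :=
  set_mulg (set_mulg B [set g]) B.

Definition double_cosets (B : set G) : set (set G) := range (double_coset B).

Definition double_coset_proj (B : set G) (g : G) : double_cosets B :=
  SigSub (mem_set (imageT (double_coset B) g)).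

End DoubleCosets.

Definition bruhat_decomposition (W : groupType) (S : set W)
    (G : groupType) (B : set G) (C : W -> double_cosets B) : Prop :=
  forall (w : W) (s : S),
    (bruhat_lt S (w * val s) w ->
       val (C (w * val s)) `<=` set_mulg (val (C w)) (val (C (val s)))
       /\ set_mulg (val (C w)) (val (C (val s)))
            `<=` val (C (w * val s)) `|` val (C w))
    /\ (bruhat_lt S w (w * val s) ->
          set_mulg (val (C w)) (val (C (val s))) = val (C (w * val s))).

(* Main.v *)
Require Import Defs.
From Stdlib Require Import Relation_Operators.
From mathcomp Require Import all_boot all_classical.

Set Implicit Arguments.
Unset Strict Implicit.

Local Open Scope classical_set_scope.
Local Open Scope group_scope.

(** Everything rests on the reflection cocycle of [W]. For a word
    [s_1 ... s_n] and a reflection [x], count modulo 2 the indices [i] with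
    [x = s_i ^ (s_(i+1) ... s_n)]; geometrically, how often the gallery of the
    word crosses the wall of [x]. The Coxeter relations preserve this parity
    ([crossing_parity_word]), so it depends only on the element [w] and gives a
    cocycle [crosses w x] ([crosses_mul]), which turns out to be equivalent to
    [w * x] being shorter than [w] ([crossesE], the strong exchange property).
    The lifting property of the Bruhat order follows: if [u <= w], then
    [u * s <= w] or [u * s <= w * s] ([bruhat_lifting]).

    From a W-groupoid [delta] on a group to property (B). Applying (WG2) to
    [g * g^-1] gives [delta g^-1 = (delta g)^-1]. If [delta k = s], then (WG2)
    bounds [delta (g * k)] from below by [delta g * s], and, applied to
    [(g * k) * k^-1], it gives [delta (g * k) * s <= delta g], which lifting
    turns into an upper bound. So [delta (g * k)] is [delta g * s] when
    multiplying by [s] goes up, and [delta g] or [delta g * s] when it goes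
    down. The other inclusions of (B) come from (WG3) and from
    [x = (x * k^-1) * k], and surjectivity by induction on the length.
    These are statements about the fibres of [delta]; injectivity of [delta_B]
    says that each fibre is a single double coset, the value of [C].

    From property (B) to a W-groupoid. (WG3) is the equality
    [C (w * s) * C s = C w] for a descent [s] of [w]. For (WG2), induct on the
    length of [delta h] and split off from [h] a first factor [k] with
    [delta k = s], say [h = k * h'] and [delta h = s * v], which iterating (B)
    allows ([decomposition_left_factor]). By induction
    [delta (g * h) >= delta (g * k) * v], and [delta (g * k)] is [delta g * s],
    or else it is [w = delta g] with [w * s < w]; in the latter case
    [w * s * v <= w * v] because [v < s * v] ([bruhat_le_mul_gen]). Splitting
    off a last factor of [h] instead would not work: [y <= x] does not imply
    [y * s <= x * s] when [s] is a descent of [x]. *)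

(** * The reflection cocycle of a Coxeter group *)

Section ReflectionCocycle.
Variables (W : groupType) (S : set W).
Implicit Types (s t : S) (r : seq S) (u v w x : W).

Lemma word_prod_nil : word_prod (S := S) [::] = 1.
Proof. exact: big_nil. Qed.

Lemma word_prod_cons s r : word_prod (s :: r) = val s * word_prod r.
Proof. exact: big_cons. Qed.

Lemma word_prod_cat r1 r2 :
  word_prod (r1 ++ r2) = word_prod r1 * word_prod r2.
Proof. exact: big_cat. Qed.

(** The sum modulo 2 runs over the positions of [r], each of which contributes
    the reflection that deletes its letter by multiplication on the right. *)
Fixpoint crossing_parity r x : bool :=
  if r is s :: r' then (x == val s ^ word_prod r') (+) crossing_parity r' x
  else false.

Lemma crossing_parity_cons s r x :
  crossing_parity (s :: r) x =
    (x == val s ^ word_prod r) (+) crossing_parity r x.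
Proof. by []. Qed.

Lemma crossing_parity_cat r1 r2 x :
  crossing_parity (r1 ++ r2) x =
    crossing_parity r1 (x ^ (word_prod r2)^-1) (+) crossing_parity r2 x.
Proof.
elim: r1 => [|s r1 IH] //=.
rewrite IH addbA word_prod_cat conjgM; congr (_ (+) _ (+) _).
by rewrite (can2_eq (conjgKV _) (conjgK _)).
Qed.

Variable coxWS : coxeter_system S.

Lemma gen_sq s : val s * val s = 1.
Proof.
have [m [[_ ms _] _ E]] := coxWS.
have /E := coxeter_rel m [::] [::] s s.
by rewrite ms /= !word_prod_cons word_prod_nil mulg1.
Qed.

Lemma genV s : (val s)^-1 = val s.
Proof. exact: (mulg1_eq (gen_sq s)). Qed.

Lemma gen_mulK s w : w * val s * val s = w.
Proof. by rewrite -mulgA gen_sq mulg1. Qed.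

Lemma gen_conj s : val s ^ val s = val s.
Proof. by rewrite conjgE mulKg. Qed.

Lemma gen_word w : exists r, word_prod (S := S) r = w.
Proof. by have [m [_ + _]] := coxWS; apply. Qed.

Lemma word_prod_alternating s t n :
  word_prod (flatten (nseq n [:: s; t])) = (val s * val t) ^+ n.
Proof.
elim: n => [|n IH]; first by rewrite word_prod_nil.
by rewrite /= !word_prod_cons IH mulgA expgS.
Qed.

Lemma conj_pow_dihedral s t n :
  (val t) ^ ((val s * val t) ^+ n) = val t * (val s * val t) ^+ (n + n).
Proof.
elim: n => [|n IH]; first by rewrite conjg1 mulg1.
have conj1 : val t ^ (val s * val t) = val t * (val s * val t) * (val s * val t).
  by rewrite conjgE invgM !genV !mulgA.
have conjp : ((val s * val t) ^+ (n + n)) ^ (val s * val t) =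
             (val s * val t) ^+ (n + n) by rewrite conjgE -expgSr expgS mulKg.
by rewrite expgSr conjgM IH conjMg conj1 conjp addnS addSn !expgS !mulgA.
Qed.

(** The reflections met by an alternating word are the elements
    [t (s t)^j] of the dihedral group; their list is periodic with the order
    of [s t], which is why the braid relators have even parity. *)
Lemma crossing_parity_alternating s t n x :
  crossing_parity (flatten (nseq n [:: s; t])) x =
    \big[addb/false]_(j < n + n) (x == val t * (val s * val t) ^+ j).
Proof.
elim: n => [|n IH]; first by rewrite big_ord0.
have -> : flatten (nseq n.+1 [:: s; t]) = s :: t :: flatten (nseq n [:: s; t]).
  by [].
rewrite addnS addSn !big_ord_recr -IH !crossing_parity_cons word_prod_cons.
rewrite word_prod_alternating conjgM conj_pow_dihedral.
have -> : val s ^ val t = val t * (val s * val t) by rewrite conjgE genV.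
rewrite conjMg conj_pow_dihedral conjgE -expgS expgSr mulKg -mulgA -expgSr.
by rewrite addbC; congr (_ (+) _); rewrite addbC.
Qed.

Lemma crossing_parity_word r r' :
  word_prod r = word_prod r' -> crossing_parity r =1 crossing_parity r'.
Proof.
have [m [_ _ E]] := coxWS.
move=> /E; elim=> {r r'} [r1 r2 s t x|//|r r' _ IH x|r r' r'' _ IH _ IH' x].
- have st1 : (val s * val t) ^+ m s t = 1.
    have /E := coxeter_rel m [::] [::] s t.
    by rewrite /= cats0 word_prod_alternating word_prod_nil.
  rewrite !crossing_parity_cat word_prod_cat word_prod_alternating st1 mul1g.
  congr (_ (+) _); rewrite -[RHS]addFb; congr (_ (+) _).
  rewrite crossing_parity_alternating big_split_ord /=.
  under [X in _ (+) X]eq_bigr => j _ do rewrite expgnDr st1 mul1g.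
  exact: addbb.
- by rewrite IH.
- by rewrite IH.
Qed.

(** The choice of the word is irrelevant by [crossing_parity_word]. *)
Definition crosses w := crossing_parity (xget [::] [set r | word_prod r = w]).

Lemma crosses_word r : crosses (word_prod r) =1 crossing_parity r.
Proof.
apply: crossing_parity_word.
exact: (@xgetI _ [::] [set r0 | word_prod r0 = word_prod r] r).
Qed.

Lemma crosses_mul u v x : crosses (u * v) x = crosses u (x ^ v^-1) (+) crosses v x.
Proof.
have [[r <-] [r' <-]] := (gen_word u, gen_word v).
by rewrite -word_prod_cat !crosses_word crossing_parity_cat.
Qed.

Lemma crosses1 x : crosses 1 x = false.
Proof. by rewrite -word_prod_nil crosses_word. Qed.

Lemma crosses_gen s x : crosses (val s) x = (x == val s).
Proof.
rewrite -[val s in LHS]mulg1 -word_prod_nil -word_prod_cons crosses_word /=.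
by rewrite word_prod_nil conjg1 addbF.
Qed.

(** Write [x = w^-1 s w]. The contributions of [w^-1] and [w] cancel, as in
    [crosses 1 x], and the middle letter contributes once. *)
Lemma crosses_reflection x : reflection S x -> crosses x x.
Proof.
move=> [s [w ->]].
have := crosses1 (val s ^ w); rewrite -{1}(mulVg w) crosses_mul conjgK => E.
have -> : crosses (val s ^ w) =1 crosses (w^-1 * val s * w).
  by move=> y; rewrite conjgE mulgA.
rewrite !crosses_mul conjgK genV gen_conj crosses_gen eqxx addbAC E.
by [].
Qed.

(** * Length and strong exchange *)

Local Notation len := (word_length S).

Lemma lengthP w : (exists2 r : seq S, word_prod r = w & size r = len w)
  /\ (forall r : seq S, word_prod r = w -> (len w <= size r)%N).
Proof.
rewrite /word_length; set A := [set n | _].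
suff : exists n, A n by move=> /(@xgetPex _ 0%N A).
have [r0 r0w] := gen_word w.
pose P n := `[< exists2 r : seq S, word_prod r = w & size r = n >].
have exP : exists n, P n by exists (size r0); apply/asboolP; exists r0.
exists (ex_minn exP); case: ex_minnP => n /asboolP Pn min; split=> // r rw.
by apply: min; apply/asboolP; exists r.
Qed.

Lemma reduced_word w : exists2 r : seq S, word_prod r = w & size r = len w.
Proof. by case: (lengthP w). Qed.

Lemma length_le r : (len (word_prod r) <= size r)%N.
Proof. by case: (lengthP (word_prod r)) => _; apply. Qed.

Lemma length1 : len 1 = 0%N.
Proof. by apply/eqP; rewrite -leqn0 -word_prod_nil length_le. Qed.

Lemma length_eq0 w : len w = 0%N -> w = 1.
Proof.
move=> w0; have [r rw] := reduced_word w; rewrite w0 -{w0}rw => /size0nil ->.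
exact: word_prod_nil.
Qed.

Lemma length_mul u v : (len (u * v) <= len u + len v)%N.
Proof.
have [[r <- <-] [r' <- <-]] := (reduced_word u, reduced_word v).
by rewrite -word_prod_cat -size_cat length_le.
Qed.

Lemma length_gen s : (len (val s) <= 1)%N.
Proof. by have := length_le [:: s]; rewrite word_prod_cons word_prod_nil mulg1. Qed.

Lemma length_gen_le w s : (len (w * val s) <= (len w).+1)%N.
Proof.
by rewrite -addn1 (leq_trans (length_mul _ _))// leq_add2l length_gen.
Qed.

(** A position contributing [x] can be deleted: multiplying by [x] on the right
    cancels its letter. *)
Lemma crossing_deletion r x : crossing_parity r x ->
  exists2 r' : seq S, word_prod r * x = word_prod r' & (size r' < size r)%N.
Proof.
elim: r => [//|s r IH] /=; have [->|_] := eqVneq x.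
  by exists r => //; rewrite word_prod_cons conjgE !mulgA mulgK gen_sq mul1g.
move=> /IH [r' rE lt_r']; exists (s :: r') => //.
by rewrite !word_prod_cons -rE mulgA.
Qed.

Lemma length_crosses w x : crosses w x -> (len (w * x) < len w)%N.
Proof.
have [r <- <-] := reduced_word w; rewrite crosses_word.
by move=> /crossing_deletion[r' -> /(leq_ltn_trans (length_le r'))].
Qed.

Lemma reflection_sq x : reflection S x -> x * x = 1.
Proof. by move=> [s [v ->]]; rewrite -conjMg gen_sq conj1g. Qed.

(** If [w] does not cross [x], then [w * x] does, since [x] crosses itself;
    hence [w = w * x * x] is shorter than [w * x]. *)
Lemma length_crossesN w x :
  reflection S x -> ~~ crosses w x -> (len w < len (w * x))%N.
Proof.
move=> Rx Nwx; rewrite -{1}[w]mulg1 -(reflection_sq Rx) mulgA.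
apply: length_crosses; rewrite crosses_mul crosses_reflection//.
by rewrite [x ^ _]conjgE invgK mulgV mulg1 (negbTE Nwx).
Qed.

Lemma crossesE w x : reflection S x -> crosses w x = (len (w * x) < len w)%N.
Proof.
move=> Rx; apply/idP/idP => [/length_crosses//|]; apply: contraLR => Nwx.
by rewrite -leqNgt ltnW// length_crossesN.
Qed.

Lemma reflection_gen s : reflection S (val s).
Proof. by exists s, 1; rewrite conjg1. Qed.

Lemma reflection_conj x w : reflection S x -> reflection S (x ^ w).
Proof. by move=> [s [v ->]]; exists s, (v * w); rewrite conjgM. Qed.

(** Lengths differ by at most one, and they are not equal since exactly one of
    [w] and [w * s] crosses [s]. *)
Lemma gen_dichotomy w s :
  len w = (len (w * val s)).+1 \/ len (w * val s) = (len w).+1.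
Proof.
have le1 := length_gen_le w s.
have le2 := length_gen_le (w * val s) s; rewrite gen_mulK in le2.
have Rs := reflection_gen s.
have Nws := crossesE w Rs; have := crossesE (w * val s) Rs.
rewrite crosses_mul crosses_gen eqxx genV gen_conj Nws gen_mulK.
by case: ltngtP le1 le2 => // lt le1 le2 _;
  [left|right]; apply/eqP; rewrite eqn_leq ?lt ?le1 ?le2.
Qed.

(** * Lifting in the Bruhat order *)

Lemma bruhat_length u w : bruhat_le S u w -> u = w \/ (len u < len w)%N.
Proof.
elim=> {u w} [u w [x _ [_ ltl]]|u|u v w _ IHu _ IHv]; [by right|by left|].
case: IHu IHv => [->//|ltu] [<-|ltv]; right=> //; exact: ltn_trans ltv.
Qed.

Lemma bruhat_le_anti u w : bruhat_le S u w -> bruhat_le S w u -> u = w.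
Proof.
move=> /bruhat_length[//|lt_uw] /bruhat_length[//|].
by rewrite ltnNge ltnW.
Qed.

Lemma bruhat_le_reflection w x : reflection S x ->
  (len w < len (w * x))%N -> bruhat_le S w (w * x).
Proof. by move=> Rx lt_w; apply: rt_step; exists x. Qed.

Lemma bruhat_le_length_gen w s :
  (len w < len (w * val s))%N -> bruhat_le S w (w * val s).
Proof. exact/bruhat_le_reflection/reflection_gen. Qed.

Lemma bruhat_lt_length w s :
  bruhat_lt S w (w * val s) <-> (len w < len (w * val s))%N.
Proof.
split=> [[/bruhat_length[]//]|lt_ws]; split; first exact: bruhat_le_length_gen.
by move=> eq_ws; rewrite -eq_ws ltnn in lt_ws.
Qed.

Lemma bruhat_gt_length w s :
  bruhat_lt S (w * val s) w <-> (len (w * val s) < len w)%N.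
Proof.
by have := bruhat_lt_length (w * val s) s; rewrite gen_mulK.
Qed.

(** For [w = u * x] with [x <> s], the steps [u -> u * x] and
    [u * s -> u * s * x ^ s = w * s] are both upwards: the generator [s] crosses
    only itself, so [u * s] crosses [x ^ s] exactly if [u] crosses [x]. *)
Lemma bruhat_step_lifting u w s : bruhat_step S u w ->
  bruhat_le S (u * val s) w \/ bruhat_le S (u * val s) (w * val s).
Proof.
move=> [x Rx [-> lt_u]]; have [->|xs] := eqVneq x (val s).
  by left; apply: rt_refl.
have -> : u * x * val s = u * val s * x ^ val s.
  by rewrite conjgE genV !mulgA gen_mulK.
have Rxs : reflection S (x ^ val s) by exact: reflection_conj.
right; apply: bruhat_le_reflection => //; apply: length_crossesN => //.
rewrite crosses_mul conjgK crosses_gen crossesE// ltnNge (ltnW lt_u) /=.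
by rewrite -[X in _ == X]gen_conj (inj_eq (@conjg_inj _ _)).
Qed.

Lemma bruhat_lifting u w s : bruhat_le S u w ->
  bruhat_le S (u * val s) w \/ bruhat_le S (u * val s) (w * val s).
Proof.
elim=> {u w} [u w|u|u v w uv IHu vw IHv]; first exact: bruhat_step_lifting.
  by right; apply: rt_refl.
case: IHu => [us_v|us_vs]; first by left; exact: rt_trans us_v vw.
by case: IHv => vs; [left|right]; exact: rt_trans us_vs vs.
Qed.

Lemma bruhat_lifting_up u w s : bruhat_le S u w ->
  (len w < len (w * val s))%N -> bruhat_le S (u * val s) (w * val s).
Proof.
move=> /(@bruhat_lifting _ _ s)[us_w|//] lt_ws.
exact: rt_trans us_w (bruhat_le_length_gen lt_ws).
Qed.

Lemma bruhat_lifting_down u w s : bruhat_le S u w ->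
  (len (w * val s) < len w)%N -> bruhat_le S (u * val s) w.
Proof.
move=> /(@bruhat_lifting _ _ s)[//|us_ws] lt_ws.
by apply: rt_trans us_ws _; have [] := proj2 (bruhat_gt_length w s) lt_ws.
Qed.

(** Here [w * s * v] and [w * v] differ by the reflection [s ^ v]. It is crossed
    by [w * v], because [v] does not cross it and [w] crosses [s]. *)
Lemma bruhat_le_mul_gen v w s : (len v < len (val s * v))%N ->
  (len (w * val s) < len w)%N -> bruhat_le S (w * val s * v) (w * v).
Proof.
have Rs := reflection_gen s; have Rsv := reflection_conj v Rs.
have sv : val s * v = v * val s ^ v by rewrite conjgE mulVKg.
move=> lt_sv; rewrite -crossesE// => Nws.
have : ~~ crosses v (val s ^ v) by rewrite crossesE// -sv -leqNgt ltnW.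
move=> Nv; rewrite -mulgA sv mulgA.
have : crosses (w * v) (val s ^ v) by rewrite crosses_mul conjgK Nws (negbTE Nv).
rewrite crossesE//.
have := @bruhat_le_reflection (w * v * val s ^ v) _ Rsv.
by rewrite -[w * v * _ * _]mulgA reflection_sq// mulg1; apply.
Qed.

Lemma exists_descent w : w <> 1 -> exists s, (len (w * val s) < len w)%N.
Proof.
move=> w1; have [r] := reduced_word w; case/lastP: r => [|r s] rw size_r.
  by case: w1; rewrite -rw word_prod_nil.
exists s; rewrite -size_r size_rcons -rw -cats1 word_prod_cat word_prod_cons.
by rewrite word_prod_nil mulg1 gen_mulK ltnS length_le.
Qed.

Lemma exists_left_descent w : w <> 1 ->
  exists s v, w = val s * v /\ (len v < len w)%N.
Proof.
move=> w1; have [[|s r]] := reduced_word w => rw size_r.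
  by case: w1; rewrite -rw word_prod_nil.
by exists s, (word_prod r); rewrite -size_r -rw word_prod_cons ltnS length_le.
Qed.

End ReflectionCocycle.

(** * Double cosets *)

Section DoubleCosets.
Variables (G : groupType) (B : set G).
Hypothesis subB : is_subgroup B.

Lemma subgroup1 : B 1.
Proof. by case: subB => /set_mem. Qed.

Lemma subgroupM x y : B x -> B y -> B (x * y).
Proof. by move=> /mem_set Bx /mem_set By; apply/set_mem/(group_closedM subB). Qed.

Lemma subgroupV x : B x -> B x^-1.
Proof. by move=> /mem_set Bx; apply/set_mem/(group_closedV subB). Qed.

Lemma double_cosetP x y :
  double_coset B x y <-> exists a b, [/\ B a, B b & y = a * x * b].
Proof.
split=> [[_ [a Ba [_ -> <-]] [b Bb <-]]|[a [b [Ba Bb ->]]]]; first by exists a, b.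
by exists (a * x); [exists a => //; exists x|exists b].
Qed.

Lemma double_coset_refl x : double_coset B x x.
Proof.
by apply/double_cosetP; exists 1, 1; split; rewrite ?mul1g ?mulg1//;
  exact: subgroup1.
Qed.

Lemma double_coset_trans x y z :
  double_coset B x y -> double_coset B y z -> double_coset B x z.
Proof.
move=> /double_cosetP[a [b [Ba Bb ->]]] /double_cosetP[c [d [Bc Bd ->]]].
apply/double_cosetP; exists (c * a), (b * d).
by split; rewrite ?mulgA//; exact: subgroupM.
Qed.

Lemma double_coset_sym x y : double_coset B x y -> double_coset B y x.
Proof.
move=> /double_cosetP[a [b [Ba Bb ->]]]; apply/double_cosetP.
exists a^-1, b^-1; split; [exact: subgroupV|exact: subgroupV|].
by rewrite -!mulgA mulgV mulg1 mulKg.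
Qed.

Lemma double_coset_eq x y : double_coset B x y -> double_coset B x = double_coset B y.
Proof.
move=> xy; apply/seteqP; split=> z; apply: double_coset_trans => //.
exact: double_coset_sym.
Qed.

Lemma double_coset_proj_eq x y :
  double_coset B x y -> double_coset_proj B y = double_coset_proj B x.
Proof. by move=> /double_coset_eq xy; apply: val_inj; rewrite /= xy. Qed.

(** This translates property (B) into a statement about the fibres of the
    function [f \o double_coset_proj B] on [G]. *)
Lemma val_inverse (W : Type) (f : double_cosets B -> W) (C : W -> double_cosets B) w :
  cancel f C -> cancel C f -> val (C w) = [set g | f (double_coset_proj B g) = w].
Proof.
move=> fC Cf.
have [x Cx] : exists x, C w = double_coset_proj B x.
  by have /set_mem[x _ xE] := valP (C w); exists x; apply: val_inj.
apply/seteqP; split=> [g|g /= <-]; last by rewrite fC; exact: double_coset_refl.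
by rewrite Cx /= => /double_coset_proj_eq ->; rewrite -Cx.
Qed.

End DoubleCosets.

(** * W-groupoids on a group *)

Section OneChamber.
Variables (W : groupType) (S : set W) (G : groupType) (delta : G -> W).
Hypothesis coxWS : coxeter_system S.
Implicit Types (s : S) (w : W) (g h k : G).
Local Notation len := (word_length S).
Local Notation "u <=_W w" := (bruhat_le S u w) (at level 70).

(** The axioms of a W-groupoid with one chamber, with the order relation in
    (WG3) expressed by lengths. *)
Definition group_W_groupoid : Prop :=
  [/\ forall s, exists g, delta g = val s,
      delta 1 = 1,
      forall g h, delta g * delta h <=_W delta (g * h)
    & forall g s, (len (delta g * val s) < len (delta g))%N ->
        exists h, delta (h^-1 * g) = val s /\ delta h = delta g * val s].

Definition fiber w : set G := [set g | delta g = w].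

(** Property (B) for the fibres of [delta], with comparisons of [w] and [w * s]
    expressed by lengths. *)
Definition fiber_decomposition : Prop := forall w s,
  ((len (w * val s) < len w)%N ->
     fiber (w * val s) `<=` set_mulg (fiber w) (fiber (val s)) /\
     set_mulg (fiber w) (fiber (val s)) `<=` fiber (w * val s) `|` fiber w) /\
  ((len w < len (w * val s))%N ->
     set_mulg (fiber w) (fiber (val s)) = fiber (w * val s)).

Section ToDecomposition.
Hypothesis deltaW : group_W_groupoid.

Let delta_gen s : exists g, delta g = val s. Proof. by case: deltaW. Qed.
Let delta1 : delta 1 = 1. Proof. by case: deltaW. Qed.
Let delta_mul g h : delta g * delta h <=_W delta (g * h).
Proof. by case: deltaW. Qed.

(** (WG2) gives [delta g * delta g^-1 <= 1], and 1 is the only element below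
    1. *)
Lemma delta_inv g : delta g^-1 = (delta g)^-1.
Proof.
have := delta_mul g g^-1; rewrite mulgV delta1.
move=> /(bruhat_length)[gV|]; first by rewrite (mulg1_eq gV).
by rewrite (length1 coxWS).
Qed.

(** (WG2) bounds [delta (g * b)] from below directly, and from above through
    [g = (g * b) * b^-1]. *)
Lemma delta_mul_kerr g b : delta b = 1 -> delta (g * b) = delta g.
Proof.
move=> b1; apply: (bruhat_le_anti (S := S)).
  by have := delta_mul (g * b) b^-1; rewrite delta_inv b1 invg1 mulg1 mulgK.
by have := delta_mul g b; rewrite b1 mulg1.
Qed.

Lemma delta_mul_kerl b g : delta b = 1 -> delta (b * g) = delta g.
Proof.
move=> b1; apply: (bruhat_le_anti (S := S)).
  by have := delta_mul b^-1 (b * g); rewrite delta_inv b1 invg1 mul1g mulKg.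
by have := delta_mul b g; rewrite b1 mul1g.
Qed.

Lemma kernel_subgroup : is_subgroup [set g | delta g = 1].
Proof.
split=> [|x y]; first exact/mem_set.
move=> /set_mem/= x1 /set_mem/= y1; apply/mem_set => /=.
by rewrite delta_mul_kerr// delta_inv y1 invg1.
Qed.

Lemma delta_double_coset x y :
  double_coset [set g | delta g = 1] x y -> delta y = delta x.
Proof.
move=> /double_cosetP[a [b [/= a1 b1 ->]]].
by rewrite delta_mul_kerr// delta_mul_kerl.
Qed.

Let delta_mul_genV g k s : delta k = val s -> delta (g * k) * val s <=_W delta g.
Proof.
move=> ks; have := delta_mul (g * k) k^-1.
by rewrite delta_inv ks (genV coxWS) mulgK.
Qed.

(** (WG2) gives one inequality. For the other, lift
    [delta (g * k) * s <= delta g] along the ascent [s] of [delta g]. *)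
Lemma delta_mul_gen_up g k s : delta k = val s ->
  (len (delta g) < len (delta g * val s))%N -> delta (g * k) = delta g * val s.
Proof.
move=> ks lt_gs; apply: (bruhat_le_anti (S := S)); last by rewrite -ks; exact: delta_mul.
have := bruhat_lifting_up coxWS (delta_mul_genV g ks) lt_gs.
by rewrite gen_mulK.
Qed.

(** Lifting gives [delta g * s <= delta (g * k) <= delta g], and the two bounds
    have consecutive lengths. *)
Lemma delta_mul_gen_down g k s : delta k = val s ->
  (len (delta g * val s) < len (delta g))%N ->
  delta (g * k) = delta g * val s \/ delta (g * k) = delta g.
Proof.
move=> ks lt_gs.
have := bruhat_lifting_down coxWS (delta_mul_genV g ks) lt_gs.
rewrite gen_mulK// => /bruhat_length[|lt_gk]; first by right.
have := delta_mul g k; rewrite ks => /bruhat_length[->|lt_gk']; first by left.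
have [gs|gs] := gen_dichotomy coxWS (delta g) s.
  by rewrite gs ltnS leqNgt lt_gk' in lt_gk.
by rewrite gs ltnNge leqnSn in lt_gs.
Qed.

Lemma delta_surj w : exists g, delta g = w.
Proof.
move: {2}(len w) (erefl (len w)) => n; elim: n w => [|n IH] w lenw.
  by exists 1; rewrite delta1 (length_eq0 coxWS lenw).
have [s lt_ws] : exists s, (len (w * val s) < len w)%N.
  by apply: (exists_descent coxWS) => w1; rewrite w1 (length1 coxWS) in lenw.
have [ws|ws] := gen_dichotomy coxWS w s; last first.
  by rewrite ws ltnNge leqnSn in lt_ws.
have [g gE] : exists g, delta g = w * val s by apply: IH; move: ws; rewrite lenw => -[].
have [k kE] := delta_gen s; exists (g * k).
by rewrite (delta_mul_gen_up kE) gE gen_mulK.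
Qed.

Lemma decomposition_of_W_groupoid : fiber_decomposition.
Proof.
have upE w s : (len w < len (w * val s))%N ->
    set_mulg (fiber w) (fiber (val s)) = fiber (w * val s).
  move=> lt_w; apply/seteqP; split=> [_ [g gw [k ks <-]]|g gws].
    by rewrite /fiber /= (delta_mul_gen_up ks) gw.
  case: deltaW => _ _ _ /(_ g s); rewrite gws gen_mulK// => /(_ lt_w)[h [ks hw]].
  by exists h => //; exists (h^-1 * g) => //; rewrite mulVKg.
move=> w s; split=> [lt_ws|]; last exact: upE.
split=> [g gws|_ [g gw [k ks <-]]]; last first.
  have := delta_mul_gen_down (g := g) ks; rewrite gw => /(_ lt_ws)[]; [by left|by right].
have [k ks] := delta_gen s.
have kVs : delta k^-1 = val s by rewrite delta_inv ks (genV coxWS).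
exists (g * k^-1); last by exists k => //; rewrite mulgVK.
by rewrite /fiber /= (delta_mul_gen_up kVs) gws gen_mulK.
Qed.

End ToDecomposition.

(** * Bruhat decompositions of a group *)

Section OfDecomposition.
Hypotheses (deltaB : fiber_decomposition) (surj : forall w, exists g, delta g = w).
Hypotheses (delta_unitl : forall b g, delta b = delta 1 -> delta (b * g) = delta g)
           (delta_unitr : forall g b, delta b = delta 1 -> delta (g * b) = delta g).

(** Otherwise [w = delta 1] has a descent [s], and (B) puts the fibre over
    [w * s] into the product of the fibre of [1] with the fibre over [s]. That
    product lies over [s], so [w * s = s]. *)
Lemma decomposition_delta1 : delta 1 = 1.
Proof.
apply: contrapT => d1; have [s lt_s] := exists_descent coxWS d1.
have [g gE] := surj (delta 1 * val s).
have [b /= b1 [k ks bk]] := ((deltaB (delta 1) s).1 lt_s).1 g gE.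
have : delta 1 * val s = 1 * val s by rewrite -gE -bk delta_unitl// mul1g.
by move=> /mulIg/d1.
Qed.

Lemma decomposition_factor g w s : (len w < len (w * val s))%N ->
  delta g = w * val s -> exists h k, [/\ delta h = w, delta k = val s & g = h * k].
Proof.
move=> lt_w gE; have /esym E := (deltaB w s).2 lt_w.
have : fiber (w * val s) g by [].
by rewrite E => -[h hw [k ks <-]]; exists h, k.
Qed.

Lemma decomposition_mul_gen_up g k s : delta k = val s ->
  (len (delta g) < len (delta g * val s))%N -> delta (g * k) = delta g * val s.
Proof.
move=> ks /((deltaB _ _).2) E.
suff : fiber (delta g * val s) (g * k) by [].
by rewrite -E; exists g => //; exists k.
Qed.

Lemma decomposition_mul_gen g k s : delta k = val s ->
  delta (g * k) = delta g * val s \/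
  delta (g * k) = delta g /\ (len (delta g * val s) < len (delta g))%N.
Proof.
move=> ks; have [gs|gs] := gen_dichotomy coxWS (delta g) s; last first.
  by left; apply: decomposition_mul_gen_up; rewrite // gs.
have lt_gs : (len (delta g * val s) < len (delta g))%N by rewrite gs.
have gk : set_mulg (fiber (delta g)) (fiber (val s)) (g * k).
  by exists g => //; exists k.
have : (fiber (delta g * val s) `|` fiber (delta g)) (g * k).
  exact: ((deltaB _ _).1 lt_gs).2.
by move=> [gE|gE]; [left|right].
Qed.

(** Property (B) only splits off last factors. Induct on the length of [v]:
    for a last letter [t] of [v], with [v = u * t], split [h] over
    [s * u * t], split the first part over [s * u], and recombine the two last
    factors over [u * t = v]. *)
Lemma decomposition_left_factor h s v : (len v < len (val s * v))%N ->
  delta h = val s * v -> exists k h', [/\ delta k = val s, delta h' = v & h = k * h'].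
Proof.
move: {2}(len v) (erefl (len v)) => n; elim: n v h => [|n IH] v h lenv.
  rewrite (length_eq0 coxWS lenv) mulg1 => _ hs; exists h, 1.
  by rewrite decomposition_delta1 mulg1.
have [t lt_vt] : exists t : S, (len (v * val t) < len v)%N.
  by apply: (exists_descent coxWS) => v1; rewrite v1 (length1 coxWS) in lenv.
have [u uE] : exists u, v * val t = u by exists (v * val t).
have vE : v = u * val t by rewrite -uE gen_mulK.
have lenu : len u = n.
  have [] := gen_dichotomy coxWS v t; rewrite uE lenv; first by case.
  by move=> ut; rewrite uE ut lenv ltnNge leqnSn in lt_vt.
have le_svt := length_gen_le coxWS (val s * u) t.
rewrite -mulgA -vE in le_svt.
move=> lt_sv; have lt_su : (len u < len (val s * u))%N.
  by rewrite lenu -ltnS -lenv (leq_trans lt_sv).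
have lt_sut : (len (val s * u) < len (val s * u * val t))%N.
  rewrite -mulgA -vE; apply: leq_trans lt_sv; rewrite ltnS lenv.
  have := length_mul coxWS (val s) u; have := length_gen coxWS s.
  by move=> s1 /leq_trans; apply; rewrite lenu -(add1n n) leq_add2r.
rewrite vE mulgA => /(decomposition_factor lt_sut)[h1 [l [h1E lt ->]]].
have [k [h2 [ks h2u ->]]] := IH _ _ lenu lt_su h1E.
exists k, (h2 * l); split=> //; last by rewrite mulgA.
by rewrite (decomposition_mul_gen_up lt) h2u -vE// lenu lenv.
Qed.

(** The first factor [k] of [h] is absorbed into [g]. When [g * k] falls in the
    fibre of [g] instead of the expected lower one, the bound only improves, by
    [bruhat_le_mul_gen]. *)
Lemma decomposition_delta_mul g h : delta g * delta h <=_W delta (g * h).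
Proof.
move: {2}(len (delta h)) (erefl (len (delta h))) => n.
elim: n g h => [|n IH] g h lenh.
  have h1 := length_eq0 coxWS lenh.
  by rewrite delta_unitr ?h1 ?decomposition_delta1// mulg1; apply: rt_refl.
have h_neq1 : delta h <> 1 by move=> h1; rewrite h1 (length1 coxWS) in lenh.
have [s [v [hE lt_v]]] := exists_left_descent coxWS h_neq1.
rewrite hE in lt_v; have [k [h' [ks h'v hkh]]] := decomposition_left_factor lt_v hE.
have lenv : len (delta h') = n.
  apply/eqP; rewrite h'v eqn_leq -ltnS -lenh hE lt_v /= -ltnS -lenh hE.
  have := length_mul coxWS (val s) v; have := length_gen coxWS s => s1 /leq_trans.
  by apply; rewrite -(add1n (len v)) leq_add2r.
have := IH (g * k) h' lenv; rewrite -mulgA -hkh h'v hE mulgA.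
have [-> //|[-> lt_gs]] := decomposition_mul_gen g ks.
by apply: rt_trans; apply: bruhat_le_mul_gen.
Qed.

Lemma W_groupoid_of_decomposition : group_W_groupoid.
Proof.
split=> [s||g h|g s lt_gs]; first exact: surj.
- exact: decomposition_delta1.
- exact: decomposition_delta_mul.
have gE : delta g = delta g * val s * val s by rewrite gen_mulK.
have [|h [k [hE ks gk]]] := @decomposition_factor g (delta g * val s) s _ gE.
  by rewrite gen_mulK.
by exists h; rewrite {1}gk mulKg.
Qed.

End OfDecomposition.
End OneChamber.

(** * The correspondence *)

Lemma bruhat_decomposition_fiber (W : groupType) (S : set W) (G : groupType)
    (B : set G) (C : W -> double_cosets B) (delta : G -> W) :
  coxeter_system S -> (forall w, val (C w) = fiber delta w) ->
  bruhat_decomposition S C <-> fiber_decomposition S delta.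
Proof.
move=> coxWS CE; split=> H w s; have := H w s; rewrite !CE => -[H1 H2].
  by split=> [/(bruhat_gt_length coxWS)|/bruhat_lt_length]; [exact: H1|exact: H2].
by split=> [/(bruhat_gt_length coxWS)|/bruhat_lt_length]; [exact: H1|exact: H2].
Qed.

Theorem mainTheorem2 (W : groupType) (S : set W) (coxWS : coxeter_system S) :
  (forall (GG : groupoid) (C0 : GG) (one_chamber : forall C : GG, C = C0)
          (delta : forall C D : GG, hom C D -> W),
     W_groupoid S delta ->
     let B := [set g : edge_group C0 | delta C0 C0 g = 1] in
     is_subgroup B
     /\ exists delta_B : double_cosets B -> W,
          (forall g : edge_group C0,
             delta_B (double_coset_proj B g) = delta C0 C0 g)
          /\ (injective delta_B ->
                bijective delta_B
                /\ exists C : W -> double_cosets B,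
                     [/\ cancel delta_B C, cancel C delta_B
                       & bruhat_decomposition S C]))
  /\
  (forall (G : groupType) (B : set G) (delta_B : double_cosets B -> W)
          (C : W -> double_cosets B),
     is_subgroup B ->
     cancel delta_B C -> cancel C delta_B ->
     bruhat_decomposition S C ->
     @W_groupoid W S (one_chamber_groupoid G)
       (fun _ _ g => delta_B (double_coset_proj B g))).
Proof.
split=> [GG C0 one_chamber delta [weak delta1 delta_mul WG3] B|].
  have deltaW : group_W_groupoid S (delta C0 C0 : edge_group C0 -> W).
    split=> [s||g h|g s lt_gs]; [|exact: delta1|exact: delta_mul|].
      by have [D] := weak C0 s; rewrite (one_chamber D).
    have /WG3[E] := (bruhat_gt_length coxWS _ s).2 lt_gs.
    by rewrite (one_chamber E).
  have subB : is_subgroup B := kernel_subgroup coxWS deltaW.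
  split=> //.
  pose rep (X : double_cosets B) : edge_group C0 :=
    xget 1 [set g | double_coset_proj B g = X].
  pose delta_B X := delta C0 C0 (rep X).
  have delta_BE g : delta_B (double_coset_proj B g) = delta C0 C0 g.
    have /(congr1 val) := xgetI (1 : edge_group C0)
      (erefl : [set h | double_coset_proj B h = double_coset_proj B g] g).
    rewrite -/(rep _) /= => E; apply: (delta_double_coset coxWS deltaW).
    by rewrite -E; exact: double_coset_refl.
  exists delta_B; split=> // delta_B_inj.
  pose C w : double_cosets B :=
    double_coset_proj B (xget 1 [set g : edge_group C0 | delta C0 C0 g = w]).
  have CK : cancel C delta_B.
    move=> w; rewrite delta_BE; have [g gw] := delta_surj coxWS deltaW w.
    exact: (xgetI (1 : edge_group C0) (gw : [set g | delta C0 C0 g = w] g)).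
  have delta_BK : cancel delta_B C by move=> X; apply: delta_B_inj; rewrite CK.
  split; first by exists C.
  exists C; split=> //.
  have CE w : val (C w) = fiber (delta C0 C0 : edge_group C0 -> W) w.
    rewrite (val_inverse subB w delta_BK CK).
    by apply: eq_set => g; rewrite delta_BE.
  apply/(bruhat_decomposition_fiber coxWS CE).
  exact: decomposition_of_W_groupoid.
move=> G B delta_B C subB delta_BK CK decC.
pose delta g := delta_B (double_coset_proj B g).
have deltaB : fiber_decomposition S delta.
  apply/(@bruhat_decomposition_fiber _ _ _ _ C delta coxWS) => // w.
  exact: val_inverse.
have surj w : exists g, delta g = w.
  have /set_mem[g _ gE] := valP (C w); exists g; rewrite /delta -[RHS]CK.
  by congr delta_B; apply: val_inj.
have inB b : delta b = delta 1 -> B b.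
  move=> /(can_inj delta_BK)/(congr1 val)/= E.
  have := double_coset_refl subB b; rewrite E.
  move=> /double_cosetP[a [c [Ba Bc ->]]]; rewrite mulg1; exact: subgroupM.
have delta_eq x y : double_coset B x y -> delta y = delta x.
  by move=> /(double_coset_proj_eq subB) xy; rewrite /delta xy.
have B1 := subgroup1 subB.
have [||weak delta1 delta_mul WG3] :=
    @W_groupoid_of_decomposition _ _ _ _ coxWS deltaB surj.
- move=> b g /inB Bb; apply: delta_eq; apply/double_cosetP.
  by exists b, 1; rewrite mulg1.
- move=> g b /inB Bb; apply: delta_eq; apply/double_cosetP.
  by exists 1, b; rewrite mul1g.
split=> [c s|c|c d e g h|c d g s].
- by have [g gs] := weak s; exists tt, g.
- exact: delta1.
- exact: delta_mul.
- by move=> /(bruhat_gt_length coxWS)/WG3[h hE]; exists tt, h.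
Qed.
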